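(* Suppose that, for every $x\in X$, $u\in\mathbb{R}^p_+$ and $v\in\mathbb{R}^q$, the function $f(x,\cdot)$ is pseudoconvex over $Y(x)\cup\mathcal{Z}(x,u,v)$ and the function $u^Tg(x,\cdot)+v^Th(x,\cdot)$ is quasiconvex over $Y(x)\cup\mathcal{Z}(x,u,v)$, and that for every $x\in X$ the problem $(\mathrm{P}_x)$ satisfies the Guignard constraint qualification at some solution $y_x\in S(x)$. Then, if $(\bar x,\bar y)$ is a (globally) optimal solution to (BP), there exists $(\bar z,\bar u,\bar v)\in\mathbb{R}^m\times\mathbb{R}^p\times\mathbb{R}^q$ such that $(\bar x,\bar y,\bar z,\bar u,\bar v)$ is a (globally) optimal solution to (MDP). Conversely, if $(\bar x,\bar y,\bar z,\bar u,\bar v)$ is a (globally) optimal solution to (MDP), then $(\bar x,\bar y)$ is a (globally) optimal solution to (BP).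
   Context: Data: $\Omega\subseteq\mathbb{R}^{n+m}$ is a set; $F:\mathbb{R}^{n+m}\to\mathbb{R}$ is continuously differentiable; $f:\mathbb{R}^{n+m}\to\mathbb{R}$, $g:\mathbb{R}^{n+m}\to\mathbb{R}^p$, $h:\mathbb{R}^{n+m}\to\mathbb{R}^q$ are twice continuously differentiable. For $x\in\mathbb{R}^n$, the lower-level problem is $(\mathrm{P}_x)$: $\min_y f(x,y)$ s.t. $g(x,y)\le 0$, $h(x,y)=0$; its feasible set is $Y(x)=\{y\in\mathbb{R}^m: g(x,y)\le0,\ h(x,y)=0\}$ and its set of (global) optimal solutions is $S(x)$. Let $X=\{x\in\mathbb{R}^n:\exists y\in\mathbb{R}^m,\ (x,y)\in\Omega\}$. Standing assumption: $S(x)\ne\emptyset$ for each $x\in X$. The bilevel program is (BP): $\min F(x,y)$ s.t. $(x,y)\in\Omega$, $y\in S(x)$. Lagrangian: $L(x,z,u,v)=f(x,z)+u^Tg(x,z)+v^Th(x,z)$; $\nabla_z$ denotes the gradient with respect to the second block of variables, and for vector-valued maps the matrix whose columns are the gradients of the components. (MDP): minimize $F(x,y)$ over $(x,y,z,u,v)\in\mathbb{R}^n\times\mathbb{R}^m\times\mathbb{R}^m\times\mathbb{R}^p\times\mathbb{R}^q$ s.t. $(x,y)\in\Omega$, $g(x,y)\le0$, $h(x,y)=0$, $f(x,y)-f(x,z)\le0$, $u^Tg(x,z)+v^Th(x,z)\ge0$, $\nabla_zf(x,z)+\nabla_zg(x,z)u+\nabla_zh(x,z)v=0$, $u\ge0$.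 $\mathcal{Z}(x,u,v)=\{z\in\mathbb{R}^m:\nabla_zL(x,z,u,v)=0,\ u^Tg(x,z)+v^Th(x,z)\ge0\}$. A differentiable $\varphi:\mathbb{R}^m\to\mathbb{R}$ is pseudoconvex on $\mathcal{Y}\subseteq\mathbb{R}^m$ if for all $y_1,y_2\in\mathcal{Y}$, $(y_1-y_2)^T\nabla\varphi(y_2)\ge0$ implies $\varphi(y_1)\ge\varphi(y_2)$; it is quasiconvex on $\mathcal{Y}$ if for all $y_1,y_2\in\mathcal{Y}$, $\varphi(y_1)\le\varphi(y_2)$ implies $(y_1-y_2)^T\nabla\varphi(y_2)\le0$. (The set $\mathcal{Y}$ need not be convex.) Guignard constraint qualification for $(\mathrm{P}_x)$ at $\bar y\in Y(x)$: $\mathcal{L}_{Y(x)}(\bar y)^\circ=\mathcal{T}_{Y(x)}(\bar y)^\circ$, where $\mathcal{T}_{Y(x)}(\bar y)=\{d:\exists\{y^k\}\subseteq Y(x),\ \exists\, t_k\downarrow0,\ y^k\to\bar y,\ (y^k-\bar y)/t_k\to d\}$, $\mathcal{L}_{Y(x)}(\bar y)=\{d:\nabla_yg_i(x,\bar y)^Td\le0 \text{ for all } i \text{ with } g_i(x,\bar y)=0,\ \nabla_yh_j(x,\bar y)^Td=0,\ j=1,\dots,q\}$, and $D^\circ=\{d:d^Ty\le0\ \forall y\in D\}$. *)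

(* Defs.v *)
From mathcomp Require Import all_boot all_order all_algebra.
From mathcomp Require Import all_classical all_reals all_analysis.
Set Implicit Arguments.
Unset Strict Implicit.
Unset Printing Implicit Defensive.
Import Order.TTheory GRing.Theory Num.Theory.
Import numFieldNormedType.Exports.
Local Open Scope classical_set_scope.
Local Open Scope ring_scope.

(* Points and directions are row vectors, while gradients and multipliers are
   column vectors: d^T (grad phi y) is written [(d *m grad phi y) 0 0] and
   u^T g is written [(g *m u) 0 0]. With this convention the matrix whose
   columns are the gradients of the components of G at y is ['J G y]. *)

Section Calculus.
Context {R : realType} {k : nat}.
Implicit Types (phi : 'rV[R]_k -> R) (A D : set 'rV[R]_k).

Definition grad phi (y : 'rV[R]_k) : 'cV[R]_k :=
  \col_i 'D_(delta_mx 0 i) phi y.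

Definition C1 phi : Prop :=
  (forall y, differentiable phi y) /\ continuous (grad phi).

Definition C2 phi : Prop :=
  C1 phi /\ forall i, C1 (fun y => grad phi y i 0).

(* As in the text, A is an arbitrary set, and phi is meant to be
   differentiable. *)
Definition pseudoconvex A phi : Prop :=
  forall y1 y2, A y1 -> A y2 ->
    0 <= ((y1 - y2) *m grad phi y2) 0 0 -> phi y2 <= phi y1.

Definition quasiconvex A phi : Prop :=
  forall y1 y2, A y1 -> A y2 ->
    phi y1 <= phi y2 -> ((y1 - y2) *m grad phi y2) 0 0 <= 0.

Definition tangent_cone A (a : 'rV[R]_k) : set 'rV[R]_k :=
  [set d | exists (y : nat -> 'rV[R]_k) (t : nat -> R),
    [/\ forall j, A (y j), forall j, 0 < t j, t @ \oo --> 0,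
        y @ \oo --> a &
        (fun j => (t j)^-1 *: (y j - a)) @ \oo --> d]].

Definition polar D : set 'rV[R]_k :=
  [set d | forall y, D y -> (d *m y^T) 0 0 <= 0].

End Calculus.

Definition minimizers {R : realType} {T : Type} (A : set T) (obj : T -> R) :
    set T :=
  [set a | A a /\ forall b, A b -> obj a <= obj b].

Section Bilevel.
Context {R : realType} {n m p q : nat}.
Variables (Omega : set 'rV[R]_(n + m)) (F f : 'rV[R]_(n + m) -> R).
Variables (g : 'rV[R]_(n + m) -> 'rV[R]_p) (h : 'rV[R]_(n + m) -> 'rV[R]_q).
Implicit Types (x : 'rV[R]_n) (y z : 'rV[R]_m) (u : 'cV[R]_p) (v : 'cV[R]_q).

Definition upper_domain : set 'rV[R]_n :=
  [set x | exists y, Omega (row_mx x y)].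

Definition lower_feasible x : set 'rV[R]_m :=
  [set y | (forall i, g (row_mx x y) 0 i <= 0) /\ h (row_mx x y) = 0].

Definition lower_solutions x : set 'rV[R]_m :=
  minimizers (lower_feasible x) (fun y => f (row_mx x y)).

Definition BP_feasible : set ('rV[R]_n * 'rV[R]_m) :=
  [set w | let: (x, y) := w in Omega (row_mx x y) /\ lower_solutions x y].

Definition BP_optimal : set ('rV[R]_n * 'rV[R]_m) :=
  minimizers BP_feasible (fun w => let: (x, y) := w in F (row_mx x y)).

Definition constraint_term x z u v : R :=
  (g (row_mx x z) *m u) 0 0 + (h (row_mx x z) *m v) 0 0.

Definition lagrangian x z u v : R :=
  f (row_mx x z) + (g (row_mx x z) *m u) 0 0 + (h (row_mx x z) *m v) 0 0.

Definition dual_set x u v : set 'rV[R]_m :=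
  [set z | grad (fun z' => lagrangian x z' u v) z = 0 /\
           0 <= constraint_term x z u v].

Definition MDP_feasible :
    set ('rV[R]_n * 'rV[R]_m * 'rV[R]_m * 'cV[R]_p * 'cV[R]_q) :=
  [set w | let: (x, y, z, u, v) := w in
    [/\ Omega (row_mx x y),
        (forall i, g (row_mx x y) 0 i <= 0) /\ h (row_mx x y) = 0,
        f (row_mx x y) - f (row_mx x z) <= 0,
        0 <= constraint_term x z u v &
        grad (fun z' => f (row_mx x z')) z
          + 'J (fun z' => g (row_mx x z')) z *m u
          + 'J (fun z' => h (row_mx x z')) z *m v = 0
        /\ (forall i, 0 <= u i 0)]].

Definition MDP_optimal :
    set ('rV[R]_n * 'rV[R]_m * 'rV[R]_m * 'cV[R]_p * 'cV[R]_q) :=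
  minimizers MDP_feasible
    (fun w => let: (x, y, _, _, _) := w in F (row_mx x y)).

Definition linearized_cone x y : set 'rV[R]_m :=
  [set d |
    (forall i, g (row_mx x y) 0 i = 0 ->
       (d *m grad (fun y' => g (row_mx x y') 0 i) y) 0 0 <= 0) /\
    (forall j, (d *m grad (fun y' => h (row_mx x y') 0 j) y) 0 0 = 0)].

Definition guignard_CQ x y : Prop :=
  polar (linearized_cone x y) = polar (tangent_cone (lower_feasible x) y).

End Bilevel.

(* Main.v *)
(* Weak duality: if (z, u, v) is feasible for the Wolfe-type dual of the lower
   level at x, then f(x, z) <= f(x, y) for every lower-level feasible y. Hence
   feasibility for (MDP) forces f(x, y) <= f(x, z) <= f(x, y') for all feasible
   y', i.e. y in S(x). In the other direction, the Guignard condition and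
   Farkas' lemma give KKT multipliers (u, v) at a solution z of the lower level,
   and (x, y, z, u, v) is then feasible for (MDP) whenever y in S(x). So the
   feasible set of (BP) is the projection of that of (MDP), and the objectives
   agree. *)

Require Import Defs.
From mathcomp Require Import all_boot all_order all_algebra.
From mathcomp Require Import all_classical all_reals all_analysis.
Set Implicit Arguments.
Unset Strict Implicit.
Unset Printing Implicit Defensive.
Import Order.TTheory GRing.Theory Num.Theory.
Import numFieldNormedType.Exports.
Local Open Scope classical_set_scope.
Local Open Scope ring_scope.

(** * Farkas' lemma *)

(** Induction on the number of columns. Either the first column [a] is redundant and gets multiplier
    0, or some [d0] violates the condition without [a], and projecting along [d0] removes [a]. *)
Lemma farkas (K : realFieldType) (m k : nat) (A : 'M[K]_(m, k))
    (b : 'cV[K]_m) :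
  (forall d : 'rV[K]_m, (forall i, (d *m A) 0 i <= 0) -> (d *m b) 0 0 <= 0) ->
  exists2 u : 'cV[K]_k, forall i, 0 <= u i 0 & b = A *m u.
Proof.
elim: k A b => [|k IHk] A b Ab.
  (* With no columns every direction is admissible; testing both signs of each basis row forces
     [b = 0]. *)
  exists 0 => [[]//|]; rewrite mulmx0; apply/matrixP=> i j.
  rewrite ord1 mxE; apply/le_anti/andP; split.
    have : ((delta_mx 0 i : 'rV_m) *m b) 0 0 <= 0 by apply: Ab; case.
    by rewrite -rowE mxE.
  have : (- (delta_mx 0 i : 'rV_m) *m b) 0 0 <= 0 by apply: Ab; case.
  by rewrite mulNmx -rowE 2!mxE oppr_le0.
rewrite -[k.+1]/(1 + k)%N in A Ab *.
pose a := lsubmx A; pose A' := rsubmx A.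
have defA : A = row_mx a A' by rewrite hsubmxK.
have colE (d : 'rV_m) : (forall i, (d *m A) 0 i <= 0) <->
    (d *m a) 0 0 <= 0 /\ forall i, (d *m A') 0 i <= 0.
  rewrite defA mul_mx_row; split=> [dA|[da dA'] i].
    split=> [|i]; first by have := dA (lshift k 0); rewrite row_mxEl.
    by have := dA (rshift 1 i); rewrite row_mxEr.
  by rewrite -(splitK i); case: (fintype.split i) => j /=;
    rewrite ?ord1 ?row_mxEl ?row_mxEr.
have [bA'|] := pselect (forall d : 'rV[K]_m,
    (forall i, (d *m A') 0 i <= 0) -> (d *m b) 0 0 <= 0).
  have [u u_ge0 ->] := IHk A' b bA'.
  exists (col_mx 0 u) => [i|]; last by rewrite defA mul_row_col mulmx0 add0r.
  by rewrite -(splitK i); case: (fintype.split i) => j /=;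
    rewrite ?col_mxEu ?col_mxEd ?mxE.
move=> /existsNP[d0 /not_implyP[d0A' /negP]]; rewrite -ltNge => d0b.
have d0a : 0 < (d0 *m a) 0 0.
  by rewrite ltNge; apply/negP => d0a; have /Ab := (colE d0).2 (conj d0a d0A');
    rewrite leNgt d0b.
(* Projecting along d0 onto the hyperplane d *m a = 0 eliminates a. *)
pose P (d : 'rV[K]_m) : 'rV[K]_m := d - ((d *m a) 0 0 / (d0 *m a) 0 0) *: d0.
pose r l (M : 'M[K]_(m, l)) : 'M[K]_(m, l) :=
  M - ((d0 *m a) 0 0)^-1 *: (a *m (d0 *m M)).
have PE l (M : 'M[K]_(m, l)) d : P d *m M = d *m r l M.
  rewrite mulmxBl mulmxBr -scalemxAl -scalemxAr [d *m (_ *m _)]mulmxA.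
  rewrite [X in _ = _ - _ *: (X *m _)]mx11_scalar mul_scalar_mx scalerA.
  by rewrite mulrC.
(* [P d] annihilates [a], so only the columns of [A'] remain to be checked. *)
have [d dA'|u u_ge0 rb] := IHk (r _ A') (r _ b).
  rewrite -PE; apply/Ab/colE; split=> [|i]; last by rewrite PE.
  rewrite mulmxBl -scalemxAl [_ 0 0]mxE [X in _ + X]mxE [X in - X]mxE.
  by rewrite divfK ?subrr// gt_eqF.
have : b = A' *m u +
    (((d0 *m b) 0 0 - (d0 *m A' *m u) 0 0) / (d0 *m a) 0 0) *: a.
  move/eqP: rb; rewrite /r subr_eq => /eqP bE.
  rewrite [LHS]bE mulmxBl -addrA; congr (_ + _).
  rewrite addrC -scalemxAl -scalerBr -!mulmxA -mulmxBr.
  rewrite [d0 *m b - _]mx11_scalar mul_mx_scalar scalerA mulrC.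
  by rewrite [X in X / _]mxE [X in _ + X]mxE.
set c := _ / _ => bE.
(* [d0] is positive on [a] and [b] but nonpositive on [A' *m u]. *)
have c_ge0 : 0 <= c.
  rewrite divr_ge0 ?(ltW d0a)// subr_ge0 (le_trans _ (ltW d0b))// mxE.
  by rewrite sumr_le0// => i _; rewrite mulr_le0_ge0.
exists (col_mx c%:M u) => [i|].
  by rewrite -(splitK i); case: (fintype.split i) => j /=;
    rewrite ?col_mxEu ?col_mxEd ?ord1 ?mxE ?mulr1n.
by rewrite defA mul_row_col mul_mx_scalar addrC.
Qed.

(** Each equality is a pair of opposite inequalities; [v] is the difference of their two
    multipliers. *)
Lemma farkas_eq (K : realFieldType) (m k l : nat) (A : 'M[K]_(m, k))
    (B : 'M[K]_(m, l)) (b : 'cV[K]_m) :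
  (forall d : 'rV[K]_m, (forall i, (d *m A) 0 i <= 0) -> d *m B = 0 ->
    (d *m b) 0 0 <= 0) ->
  exists (u : 'cV[K]_k) (v : 'cV[K]_l),
    (forall i, 0 <= u i 0) /\ b = A *m u + B *m v.
Proof.
move=> ABb.
have [d dAB|w w_ge0 ->] := @farkas K m _ (row_mx A (row_mx B (- B))) b.
  apply: ABb => [i|].
    by have := dAB (lshift _ i); rewrite mul_mx_row row_mxEl.
  apply/rowP => i; rewrite [RHS]mxE; apply/le_anti/andP; split.
    have := dAB (rshift _ (lshift _ i)).
    by rewrite !mul_mx_row row_mxEr row_mxEl.
  have := dAB (rshift _ (rshift _ i)).
  by rewrite !mul_mx_row !row_mxEr mulmxN mxE oppr_le0.
exists (usubmx w), (usubmx (dsubmx w) - dsubmx (dsubmx w)); split=> [i|].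
  by rewrite mxE.
rewrite -[in LHS](vsubmxK w) -[in LHS](vsubmxK (dsubmx w)) !mul_row_col.
by rewrite mulmxBr mulNmx.
Qed.

(** * Differential calculus and first-order optimality *)

Lemma differentiable_rV (R : realType) (V : normedModType R) (l : nat)
    (G : V -> 'rV[R]_l) (a : V) :
  (forall i, differentiable (fun x => G x 0 i) a) -> differentiable G a.
Proof.
move=> dG; have -> : G = \sum_(i < l) (fun x => G x 0 i *: delta_mx 0 i).
  by apply/funext => x; rewrite fct_sumE [LHS]row_sum_delta.
by apply: differentiable_sum => i; exact: differentiableZl.
Qed.

Lemma differentiable_row_mxr (R : realType) (n m : nat) (x : 'rV[R]_n)
    (y : 'rV[R]_m) :
  differentiable (fun y' : 'rV[R]_m => row_mx x y' : 'rV[R]_(n + m)) y.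
Proof.
apply: differentiable_rV => i; rewrite -(splitK i).
case: (fintype.split i) => j /=; last first.
  under eq_fun do rewrite row_mxEr; exact: differentiable_coord.
under eq_fun do rewrite row_mxEl; exact: differentiable_cst.
Qed.

Lemma diff_grad (R : realType) (k : nat) (phi : 'rV[R]_k -> R)
    (a d : 'rV[R]_k) :
  differentiable phi a -> 'd phi a d = (d *m grad phi a) 0 0.
Proof.
move=> dphi; rewrite [d in LHS]row_sum_delta linear_sum mxE.
by apply: eq_bigr => i _; rewrite linearZ mxE deriveE.
Qed.

Lemma jacobian_grad (R : realType) (k l : nat) (G : 'rV[R]_k -> 'rV[R]_l)
    (a : 'rV[R]_k) : differentiable G a ->
  'J G a = \matrix_(i, j) grad (fun y => G y 0 j) a i 0.
Proof.
move=> dG; apply/matrixP => i j; rewrite !mxE -deriveE// derive_mx ?mxE//.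
exact: diff_derivable.
Qed.

Lemma gradD (R : realType) (k : nat) (phi psi : 'rV[R]_k -> R) (a : 'rV[R]_k) :
  differentiable phi a -> differentiable psi a ->
  grad (fun y => phi y + psi y) a = grad phi a + grad psi a.
Proof.
move=> dphi dpsi; apply/matrixP => i j; rewrite !mxE.
by apply: deriveD; exact: diff_derivable.
Qed.

Section MulmxCol.
Context {R : realType} {k l : nat}.
Variables (G : 'rV[R]_k -> 'rV[R]_l) (u : 'cV[R]_l) (a : 'rV[R]_k).
Hypothesis dG : differentiable G a.

Let mulmx_colE :
  (fun y => (G y *m u) 0 0) = \sum_(j < l) (u j 0 *: (fun y => G y 0 j)).
Proof.
apply/funext => y; rewrite fct_sumE mxE; apply: eq_bigr => j _.
by rewrite mulrC.
Qed.

Let dGj j : differentiable (fun y => G y 0 j) a.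
Proof. exact: (differentiable_comp dG (differentiable_coord _ _ _)). Qed.

Lemma differentiable_mulmx_col : differentiable (fun y => (G y *m u) 0 0) a.
Proof.
by rewrite mulmx_colE; apply: differentiable_sum => j; exact: differentiableZ.
Qed.

Lemma grad_mulmx_col : grad (fun y => (G y *m u) 0 0) a = 'J G a *m u.
Proof.
rewrite jacobian_grad// mulmx_colE; apply/matrixP => i j; rewrite ord1 !mxE.
rewrite derive_sum => [|j']; last exact/derivableZ/diff_derivable.
apply: eq_bigr => j' _; rewrite deriveZ; last exact: diff_derivable.
by rewrite !mxE mulrC.
Qed.

End MulmxCol.

(** Expand [phi] to first order along the sequence defining [d], divide by [t j], and pass to the
    limit. *)
Lemma tangent_cone_minimum (R : realType) (k : nat) (A : set 'rV[R]_k)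
    (phi : 'rV[R]_k -> R) (a d : 'rV[R]_k) :
  differentiable phi a -> (forall y, A y -> phi a <= phi y) ->
  tangent_cone A a d -> 0 <= (d *m grad phi a) 0 0.
Proof.
move=> dphi phi_min [y [t [yA t_gt0 _ ya yd]]]; rewrite -diff_grad//.
set e : nat -> 'rV[R]_k := fun j => _ in yd.
rewrite leNgt; apply/negP => d_lt0.
suff lin_ge (eps : R) : 0 < eps -> 0 <= 'd phi a d + eps * `|d|.
  (* This [eps] times the norm of [d] is strictly smaller than [- 'd phi a d], which contradicts
     [lin_ge]. *)
  have := lin_ge (- 'd phi a d / (`|d| + 1)).
  rewrite divr_gt0 ?oppr_gt0 ?ltr_wpDl// => /(_ isT); apply/negP.
  rewrite -ltNge mulrAC -mulrA mulNr subr_lt0.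
  by rewrite ltr_nMr// ltr_pdivrMr ?ltr_wpDl// mul1r ltrDl.
move=> eps_gt0.
(* Eventually the Taylor remainder is at most [eps] times the norm of [y j - a]. Minimality makes
   the increment of [phi] nonnegative, and the resulting bound is homogeneous, hence survives
   scaling by the inverse of [t j]. *)
have near_ge : \forall j \near \oo, 0 <= 'd phi a (e j) + eps * `|e j|.
  have y0 : (fun j => y j - a) @ \oo --> (0 : 'rV[R]_k).
    by rewrite -(subrr a); apply: cvgB => //; exact: cvg_cst.
  have /eqaddoP/(_ _ eps_gt0)/y0 := diff_locally dphi.
  rewrite !near_simpl; apply: filterS => j /=.
  rewrite /= !fctE subrK opprD addrA => /ler_normlW phi_le.
  have : 0 <= 'd phi a (y j - a) + eps * `|y j - a|.
    by rewrite -lerBlDl sub0r (le_trans _ phi_le)// lerDr subr_ge0 phi_min.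
  rewrite /e linearZ/= normrZ gtr0_norm ?invr_gt0//.
  by rewrite mulrCA -mulrDr => ?; rewrite mulr_ge0// invr_ge0 ltW.
have := @cvgr_to_ge nat \oo _ R _ _ 0 _ near_ge; apply.
apply: cvgD.
  by apply: (cvg_comp _ _ yd); exact: (diff_continuous dphi).
by apply: cvgM; [exact: cvg_cst|exact: cvg_norm].
Qed.

(** * Weak duality and KKT conditions for the lower level *)

Section LowerLevel.
Context {R : realType} {n m p q : nat}.
Variables (f : 'rV[R]_(n + m) -> R) (x : 'rV[R]_n).
Variables (g : 'rV[R]_(n + m) -> 'rV[R]_p) (h : 'rV[R]_(n + m) -> 'rV[R]_q).
Implicit Types (y z : 'rV[R]_m) (u : 'cV[R]_p) (v : 'cV[R]_q).
Hypothesis df : forall z : 'rV[R]_m, differentiable (fun y => f (row_mx x y)) z.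
Hypothesis dg : forall z : 'rV[R]_m, differentiable (fun y => g (row_mx x y)) z.
Hypothesis dh : forall z : 'rV[R]_m, differentiable (fun y => h (row_mx x y)) z.

(** Written as the stationarity constraint of [MDP_feasible], so that the two agree by
    conversion. *)
Definition KKT_residual (z : 'rV[R]_m) (u : 'cV[R]_p) (v : 'cV[R]_q) :
    'cV[R]_m :=
  grad (fun y => f (row_mx x y)) z + 'J (fun y => g (row_mx x y)) z *m u
    + 'J (fun y => h (row_mx x y)) z *m v.

Lemma grad_constraint_term z u v :
  grad (fun y => constraint_term g h x y u v) z =
  'J (fun y => g (row_mx x y)) z *m u + 'J (fun y => h (row_mx x y)) z *m v.
Proof.
rewrite gradD; [|exact: differentiable_mulmx_col..].
by rewrite !grad_mulmx_col.
Qed.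

Lemma grad_lagrangian z u v :
  grad (fun y => lagrangian f g h x y u v) z = KKT_residual z u v.
Proof.
rewrite /lagrangian gradD; last exact: differentiable_mulmx_col.
  rewrite gradD//; last exact: differentiable_mulmx_col.
  by rewrite !grad_mulmx_col.
by apply: differentiableD => //; exact: differentiable_mulmx_col.
Qed.

Lemma constraint_term_le0 y u v : lower_feasible g h x y ->
  (forall i, 0 <= u i 0) -> constraint_term g h x y u v <= 0.
Proof.
move=> [gy hy] u_ge0; rewrite /constraint_term hy mul0mx [X in _ + X]mxE addr0.
by rewrite mxE sumr_le0// => i _; rewrite mulr_le0_ge0.
Qed.

(* Quasiconvexity of the constraint term at z turns, through stationarity of
   the Lagrangian, into the premise of pseudoconvexity of f. *)
Lemma dual_weak_duality y z u v :
  pseudoconvex (lower_feasible g h x `|` dual_set f g h x u v)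
    (fun y => f (row_mx x y)) ->
  quasiconvex (lower_feasible g h x `|` dual_set f g h x u v)
    (fun y => constraint_term g h x y u v) ->
  lower_feasible g h x y -> (forall i, 0 <= u i 0) ->
  0 <= constraint_term g h x z u v -> KKT_residual z u v = 0 ->
  f (row_mx x z) <= f (row_mx x y).
Proof.
move=> pf qc Yy u_ge0 ct_ge0 stat.
have Zz : dual_set f g h x u v z by split=> //; rewrite grad_lagrangian.
apply: pf; [by left|by right|].
(* The term is nonpositive at the feasible [y] and nonnegative at [z]. *)
have := qc y z (or_introl Yy) (or_intror Zz)
  (le_trans (constraint_term_le0 v Yy u_ge0) ct_ge0).
rewrite grad_constraint_term.
move: stat; rewrite /KKT_residual -addrA => /eqP; rewrite addr_eq0 => /eqP ->.
by rewrite mulmxN [X in _ -> 0 <= X]mxE oppr_ge0.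
Qed.

(** By minimality the negative gradient of [f] lies in the polar of the tangent cone, which the
    Guignard condition identifies with the polar of the linearized cone; Farkas' lemma then yields
    the multipliers. *)
Lemma KKT_of_guignard y : lower_solutions f g h x y -> guignard_CQ g h x y ->
  exists (u : 'cV[R]_p) (v : 'cV[R]_q),
    [/\ forall i, 0 <= u i 0, constraint_term g h x y u v = 0 &
        KKT_residual y u v = 0].
Proof.
move=> [[gy hy] ymin] CQ.
(* Zeroing the inactive columns makes their inequalities trivial while keeping the index type of the
   multipliers. *)
pose A : 'M[R]_(m, p) := \matrix_(i, j)
  if g (row_mx x y) 0 j == 0 then 'J (fun y => g (row_mx x y)) y i j else 0.
have [d dA dB|u [v [u_ge0 /eqP]]] := @farkas_eq R m p q A
    ('J (fun y => h (row_mx x y)) y) (- grad (fun y => f (row_mx x y)) y).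
  have : polar (linearized_cone g h x y)
      (- (grad (fun y => f (row_mx x y)) y)^T).
    rewrite CQ => e eT; rewrite mulNmx mxE oppr_le0.
    (* [polar] pairs two rows; transposing the one-by-one product recovers a row times a
       gradient. *)
    rewrite -[X in X *m _]trmxK -trmx_mul mxE trmxK.
    exact: tangent_cone_minimum eT.
  rewrite mulmxN [X in X <= 0]mxE => /(_ d).
  rewrite mulNmx -trmx_mul [in X in X -> _]mxE [in X in X -> _]mxE.
  apply; split=> [j gj0|j].
    apply: le_trans (dA j); rewrite le_eqVlt !mxE; apply/orP; left; apply/eqP.
    apply: eq_bigr => i _.
    by rewrite [in RHS]mxE gj0 eqxx jacobian_grad// [in RHS]mxE.
  have /rowP/(_ j) := dB; rewrite jacobian_grad// mxE [RHS]mxE => dBj.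
  rewrite mxE -[RHS]dBj.
  by apply: eq_bigr => i _; rewrite !mxE.
rewrite eq_sym -subr_eq0 opprK => /eqP stat.
(* A has zero columns at the inactive constraints, so u can be replaced there
   by 0, which gives complementary slackness. *)
pose w : 'cV[R]_p := \col_j if g (row_mx x y) 0 j == 0 then u j 0 else 0.
exists w, v; split=> [j||].
- by rewrite mxE; case: ifP.
- rewrite /constraint_term hy mul0mx [X in _ + X]mxE addr0 mxE big1// => j _.
  by rewrite mxE; case: eqP => [->|_]; rewrite ?mul0r ?mulr0.
- rewrite -[RHS]stat /KKT_residual [RHS]addrC addrA; congr (_ + _ + _).
  apply/colP => i; rewrite !mxE; apply: eq_bigr => j _.
  by rewrite [w _ _]mxE [A _ _]mxE; case: ifP; rewrite ?mul0r ?mulr0.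
Qed.

End LowerLevel.

Theorem theorem3p1 (R : realType) (n m p q : nat)
    (Omega : set 'rV[R]_(n + m)) (F f : 'rV[R]_(n + m) -> R)
    (g : 'rV[R]_(n + m) -> 'rV[R]_p) (h : 'rV[R]_(n + m) -> 'rV[R]_q)
    (F_C1 : C1 F) (f_C2 : C2 f)
    (g_C2 : forall i : 'I_p, C2 (fun w => g w 0 i))
    (h_C2 : forall j : 'I_q, C2 (fun w => h w 0 j))
    (S_neq0 : forall x : 'rV[R]_n,
       upper_domain Omega x -> lower_solutions f g h x !=set0)
    (convexity : forall (x : 'rV[R]_n) (u : 'cV[R]_p) (v : 'cV[R]_q),
       upper_domain Omega x -> (forall i : 'I_p, 0 <= u i 0) ->
       pseudoconvex (lower_feasible g h x `|` dual_set f g h x u v)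
         (fun y => f (row_mx x y)) /\
       quasiconvex (lower_feasible g h x `|` dual_set f g h x u v)
         (fun y => constraint_term g h x y u v))
    (guignard : forall x : 'rV[R]_n, upper_domain Omega x ->
       exists2 y : 'rV[R]_m, lower_solutions f g h x y & guignard_CQ g h x y) :
  (forall (x : 'rV[R]_n) (y : 'rV[R]_m),
     BP_optimal Omega F f g h (x, y) ->
     exists (z : 'rV[R]_m) (u : 'cV[R]_p) (v : 'cV[R]_q),
       MDP_optimal Omega F f g h (x, y, z, u, v)) /\
  (forall (x : 'rV[R]_n) (y z : 'rV[R]_m) (u : 'cV[R]_p) (v : 'cV[R]_q),
     MDP_optimal Omega F f g h (x, y, z, u, v) ->
     BP_optimal Omega F f g h (x, y)).
Proof.
have slice l (G : 'rV[R]_(n + m) -> 'rV[R]_l) (x : 'rV[R]_n) (z : 'rV[R]_m) :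
    (forall i, C2 (fun w => G w 0 i)) ->
    differentiable (fun y => G (row_mx x y)) z.
  move=> G_C2; apply: differentiable_rV => i.
  have [[dG _] _] := G_C2 i.
  exact: (differentiable_comp (differentiable_row_mxr x z) (dG (row_mx x z))).
have df x z : differentiable (fun y : 'rV[R]_m => f (row_mx x y)) z.
  have [[df _] _] := f_C2.
  exact: (differentiable_comp (differentiable_row_mxr x z) (df (row_mx x z))).
have dg x z := slice _ _ x z g_C2.
have dh x z := slice _ _ x z h_C2.
have BP_MDP x y : BP_feasible Omega f g h (x, y) ->
    exists z u v, MDP_feasible Omega f g h (x, y, z, u, v).
  move=> [Oxy [Yy ymin]].
  have Xx : upper_domain Omega x by exists y.
  (* The qualified solution [z] may differ from [y]; the multipliers are taken at [z], and both have
     the same lower-level value. *)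
  have [z Sz CQ] := guignard x Xx.
  have [u [v [u_ge0 ct0 stat]]] := KKT_of_guignard (df x) (dg x) (dh x) Sz CQ.
  exists z, u, v; split=> //; last by rewrite ct0.
  by rewrite subr_le0; apply: ymin; case: Sz.
have MDP_BP x y z u v : MDP_feasible Omega f g h (x, y, z, u, v) ->
    BP_feasible Omega f g h (x, y).
  move=> [Oxy Yy fyz ct_ge0 [stat u_ge0]]; split=> //; split=> // y' Yy'.
  have Xx : upper_domain Omega x by exists y.
  have [pf qc] := convexity x u v Xx u_ge0.
  rewrite subr_le0 in fyz; apply: le_trans fyz _.
  exact: (dual_weak_duality (df x) (dg x) (dh x) pf qc).
(* The objective depends on [x] and [y] only, so competitors pass between the two programs with
   their value unchanged. *)
split=> [x y [xyF xyB]|x y z u v [w_feas wB]].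
  have [z [u [v w_feas]]] := BP_MDP _ _ xyF; exists z, u, v; split=> //.
  by move=> [[[[x' y'] z'] u'] v'] /MDP_BP/xyB.
split; first exact: MDP_BP w_feas.
by move=> [x' y'] /BP_MDP[z' [u' [v' /wB]]].
Qed.
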